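(* Let $(X,f)$ be a quasi-continuous dynamical system. If $X$ is fragmented by a metric $\rho$ such that the topology generated by $\rho$ contains the topology of the space $X$, then $C^{\infty}(f)$ is a residual set in $X$. Furthermore, if $X$ is also a Baire space, then $C^{\infty}(f)$ contains a dense $G_\delta$-set.
   Context: $\mathbb N$ denotes the set of nonnegative integers. A dynamical system is a pair $(X,f)$ where $X$ is a topological space (with at least two points) and $f:X\to X$ is a map, not necessarily continuous. A map $g:X\to Y$ between topological spaces is quasi-continuous if for every $x_0\in X$, every open neighbourhood $W$ of $g(x_0)$ and every open neighbourhood $U$ of $x_0$, there is a nonempty open set $V\subseteq U$ with $g(V)\subseteq W$. The system $(X,f)$ is quasi-continuous if $f^n$ is quasi-continuous for every $n\in\mathbb N$. $C^{\infty}(f)=\{x\in X: f^n \text{ is continuous at } x \text{ for all } n\in\mathbb N\}$. Let $\rho$ be a metric on the set $X$. The topological space $X$ is fragmented by $\rho$ if for every $\epsilon>0$ and every nonempty $A\subseteq X$ there is a nonempty $B\subseteq A$, relatively open in $A$ (for the topology of $X$), with $\rho$-diameter of $B$ less than $\epsilon$. A subset $R\subseteq X$ is residual if $X\setminus R$ is a countable union of nowhere dense subsets of $X$. *)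

(* Defs.v *)
From mathcomp Require Import all_boot all_order all_algebra.
From mathcomp Require Import all_classical all_reals all_analysis.

Set Implicit Arguments.
Unset Strict Implicit.
Unset Printing Implicit Defensive.

Import Order.TTheory GRing.Theory Num.Theory.

Local Open Scope classical_set_scope.
Local Open Scope ring_scope.

Definition quasi_continuous {X Y : topologicalType} (g : X -> Y) : Prop :=
  forall (x0 : X) (W : set Y) (U : set X),
    open_nbhs (g x0) W -> open_nbhs x0 U ->
    exists V : set X, [/\ open V, V !=set0, V `<=` U & g @` V `<=` W].

Definition quasi_continuous_system {X : topologicalType} (f : X -> X) : Prop :=
  forall n : nat, quasi_continuous (iter n f).

Definition Cinfty {X : topologicalType} (f : X -> X) : set X :=
  [set x | forall n : nat, {for x, continuous (iter n f)}].

(* A metric on the bare set X, a priori unrelated to the topology of X; this is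
   why X is not assumed to be a [metricType]. *)
Record is_metric {R : realType} {X : Type} (rho : X -> X -> R) : Prop := {
  metric_ge0 : forall x y, 0 <= rho x y ;
  metric_eq0 : forall x y, rho x y = 0 <-> x = y ;
  metric_symm : forall x y, rho x y = rho y x ;
  metric_trian : forall x y z, rho x z <= rho x y + rho y z }.

Definition metric_ball {R : realType} {X : Type} (rho : X -> X -> R)
  (x : X) (e : R) : set X := [set y | rho x y < e].

Definition metric_open {R : realType} {X : Type} (rho : X -> X -> R)
  (A : set X) : Prop :=
  forall x, A x -> exists2 e : R, 0 < e & metric_ball rho x e `<=` A.

(* Extended-real valued: +oo for unbounded sets (and -oo for the empty set). *)
Definition diameter {R : realType} {X : Type} (rho : X -> X -> R)
  (B : set X) : \bar R :=
  ereal_sup [set (rho p.1 p.2)%:E | p in B `*` B].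

Definition relatively_open {X : topologicalType} (A B : set X) : Prop :=
  exists2 O : set X, open O & B = A `&` O.

Definition fragmented_by {R : realType} (X : topologicalType)
  (rho : X -> X -> R) : Prop :=
  forall (e : R) (A : set X), 0 < e -> A !=set0 ->
    exists B : set X,
      [/\ B !=set0, B `<=` A, relatively_open A B
        & (diameter rho B < e%:E)%E].

Definition nowhere_dense {X : topologicalType} (A : set X) : Prop :=
  interior (closure A) = set0.

Definition residual {X : topologicalType} (S : set X) : Prop :=
  exists2 F : nat -> set X,
    (forall i, nowhere_dense (F i)) & ~` S = \bigcup_i F i.

Definition baire_space (X : topologicalType) : Prop :=
  forall F : nat -> set X,
    (forall i, open (F i) /\ dense (F i)) -> dense (\bigcap_i F i).

(* Main.v *)
Require Import Defs.
From mathcomp Require Import all_boot all_order all_algebra.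
From mathcomp Require Import all_classical all_reals all_analysis borel_hierarchy.

(** Fix an iterate [f^n] and [e > 0], and let [small_oscillation] be the union
    of the open sets whose image under [f^n] is [e]-small for [rho].

    This open set is dense.  Inside a nonempty open [U], fragmentability of the
    image [f^n(U)] yields an open [W] that meets [f^n(U)] in a nonempty [e]-small
    set; quasi-continuity at a point of [U] sent into [W] then turns the condition
    of landing in [W] into a nonempty open [V] inside [U] with [f^n(V)] inside
    [W], hence [e]-small.

    A point lying in all these sets, for [e = 1/(k+1)], is a point of continuity
    of [f^n], because [rho]-balls are finer than the neighbourhoods of [X].
    Letting [n] vary too, the set of points of continuity of all the iterates
    contains a countable intersection of dense open sets.  Such a set is residual,
    and in a Baire space the intersection itself is the required dense
    [G_delta]. *)

Import Order.TTheory GRing.Theory Num.Theory.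

Local Open Scope classical_set_scope.
Local Open Scope ring_scope.

Definition small_oscillation {R : realType} {X Y : topologicalType}
    (g : X -> Y) (rho : Y -> Y -> R) (e : R) : set X :=
  [set x | exists2 U : set X, open_nbhs x U &
     forall u v, U u -> U v -> rho (g u) (g v) < e].

Lemma open_small_oscillation {R : realType} {X Y : topologicalType}
    (g : X -> Y) (rho : Y -> Y -> R) (e : R) :
  open (small_oscillation g rho e).
Proof.
rewrite openE => x [U [oU Ux] small_U].
rewrite /interior nbhsE; exists U => // y Uy.
by exists U.
Qed.

Lemma diameter_lt {R : realType} {X : Type} (rho : X -> X -> R)
    (B : set X) (e : R) (x y : X) :
  (diameter rho B < e%:E)%E -> B x -> B y -> rho x y < e.
Proof.
move=> diamB Bx By; rewrite -lte_fin; apply: le_lt_trans diamB.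
by apply: ereal_sup_ubound; exists (x, y).
Qed.

(** The fragmented set is the image of the given open set, and not the open set
    itself: its [e]-small relatively open piece is cut out by an open subset of
    the codomain, which is what quasi-continuity can pull back. *)
Lemma dense_small_oscillation {R : realType} {X Y : topologicalType}
    (g : X -> Y) (rho : Y -> Y -> R) (e : R) :
  quasi_continuous g -> fragmented_by rho -> 0 < e ->
  dense (small_oscillation g rho e).
Proof.
move=> qc_g frag e_gt0 U [x Ux] oU.
have [|B [[b Bb] _ [W oW BE] diamB]] := frag e (g @` U) e_gt0.
  by exists (g x), x.
have : (g @` U `&` W) b by rewrite -BE.
move=> [[x0 Ux0 <-] Wgx0].
have [V [oV [v Vv] VU gVW]] := qc_g x0 W U (conj oW Wgx0) (conj oU Ux0).
have VB u : V u -> B (g u).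
  by move=> Vu; rewrite BE; split; [exists u; [exact: VU|]|apply: gVW; exists u].
exists v; split; first exact: VU.
by exists V => // u w Vu Vw; apply: diameter_lt diamB _ _; exact: VB.
Qed.

Lemma continuous_small_oscillation {R : realType} {X Y : topologicalType}
    (g : X -> Y) (rho : Y -> Y -> R) (x : X) :
  (forall A : set Y, open A -> metric_open rho A) ->
  (forall k : nat, small_oscillation g rho k.+1%:R^-1 x) ->
  {for x, continuous g}.
Proof.
move=> finer small_x A; rewrite nbhsE => -[W [oW Wgx] WA].
have [e e_gt0 ballW] := finer W oW (g x) Wgx.
have [k _ /(_ k (leqnn k)) k_lt] := near_infty_natSinv_lt (PosNum e_gt0).
have [U xU small_U] := small_x k.
apply: filterS (open_nbhs_nbhs xU) => u Uu; apply/WA/ballW.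
by apply: lt_trans k_lt; apply: small_U => //; case: xU.
Qed.

Lemma nowhere_dense_setC {X : topologicalType} (G A : set X) :
  open G -> dense G -> A `<=` ~` G -> nowhere_dense A.
Proof.
move=> oG dG AG; rewrite /nowhere_dense -subset0 => x xA.
have [|y [yA Gy]] := dG _ _ (open_interior (closure A)); first by exists x.
have /closureS/(_ _ (interior_subset yA)) := AG.
by rewrite -(closure_id _).1 //; exact: open_closedC.
Qed.

(** Residuality asks for an exact decomposition of the complement of [S], whereas
    the complements of the [G i] may overflow it; they are therefore cut down to
    that complement. *)
Lemma residual_bigcap {X : topologicalType} (G : nat -> set X) (S : set X) :
  (forall i, open (G i) /\ dense (G i)) -> \bigcap_i G i `<=` S -> residual S.
Proof.
move=> odG GS; exists (fun i => ~` S `&` ~` G i) => [i|].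
  by have [oG dG] := odG i; apply: nowhere_dense_setC oG dG _ => x [].
rewrite -setI_bigcupr -setC_bigcap; apply/esym/setIidPl.
exact: subsetC.
Qed.

Theorem proposition3p5 (R : realType) (X : topologicalType) (f : X -> X)
    (rho : X -> X -> R) :
  (exists x y : X, x <> y) ->
  quasi_continuous_system f ->
  is_metric rho ->
  (forall A : set X, open A -> metric_open rho A) ->
  fragmented_by rho ->
  residual (Cinfty f) /\
  (baire_space X ->
    exists D : set X, [/\ Gdelta D, dense D & D `<=` Cinfty f]).
Proof.
move=> _ qc_f _ finer frag.
(* A single sequence must run over all pairs (n, k); the default value is used
   at the integers that encode no pair. *)
pose code i : nat * nat := odflt (0, 0)%N (unpickle i).
pose G i := small_oscillation (iter (code i).1 f) rho (code i).2.+1%:R^-1.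
have odG i : open (G i) /\ dense (G i).
  split; first exact: open_small_oscillation.
  by apply: dense_small_oscillation; rewrite ?invr_gt0.
have GC : \bigcap_i G i `<=` Cinfty f.
  move=> x Gx n; apply: continuous_small_oscillation finer _ => k.
  by have := Gx (pickle (n, k)) I; rewrite /G /code pickleK.
split; first exact: residual_bigcap odG GC.
move=> baire; exists (\bigcap_i G i); split=> //; last exact: baire.
by exists G => // i; have [] := odG i.
Qed.
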